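(* Let $L$ be a finite-dimensional Lie algebra over $\mathbb{F}$, and let $I$ and $J$ be two near perfect ideals of $L$. Then $I+J$ is also a near perfect ideal of $L$.
   Context: $\mathbb{F}$ denotes either the field of real numbers or the field of complex numbers. For ideals $I,J$ of $L$, $I+J=\{x+y: x\in I, y\in J\}$ and $[I,J]$ is the linear span of all brackets $[x,y]$ with $x\in I$, $y\in J$. An ideal $I$ of $L$ is called a near perfect ideal of $L$ if $[L,I]=I$. *)

(* Defs.v *)
From HB Require Import structures.
From mathcomp Require Import all_boot all_order all_algebra.
From mathcomp Require Import complex.
From mathcomp Require Import boolp classical_sets reals.

Set Implicit Arguments.
Unset Strict Implicit.
Unset Printing Implicit Defensive.

Import GRing.Theory.
Local Open Scope ring_scope.
Local Open Scope classical_set_scope.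

Variant ground_field := RealNumbers | ComplexNumbers.

Definition scalars (R : realType) (k : ground_field) : fieldType :=
  match k with
  | RealNumbers => R
  | ComplexNumbers => R[i]
  end.

(* Finite dimensionality comes from vectType. *)
HB.mixin Record Vector_isLieAlgebra (F : fieldType) L of Vector F L := {
  bracket : L -> L -> L;
  bracket_linear_l : forall (a : F) (x y z : L),
    bracket (a *: x + y) z = a *: bracket x z + bracket y z;
  bracket_linear_r : forall (a : F) (x y z : L),
    bracket z (a *: x + y) = a *: bracket z x + bracket z y;
  bracket_alternating : forall x : L, bracket x x = 0;
  bracket_jacobi : forall x y z : L,
    bracket x (bracket y z) + bracket y (bracket z x)
      + bracket z (bracket x y) = 0
}.

#[short(type="lieAlgType")]
HB.structure Definition LieAlgebra (F : fieldType) :=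
  { L of Vector F L & Vector_isLieAlgebra F L }.

Definition linear_span (F : fieldType) (V : vectType F) (S : set V) : set V :=
  [set v | exists (n : nat) (a : 'I_n -> F) (s : 'I_n -> V),
             (forall i, S (s i)) /\ v = \sum_(i < n) a i *: s i].

(* The span of the brackets, not merely the set of brackets. *)
Definition bracket_span (F : fieldType) (L : lieAlgType F)
    (I J : {vspace L}) : set L :=
  linear_span [set z | exists x y, [/\ x \in I, y \in J & z = bracket x y]].

(* One-sided closure suffices: the bracket is antisymmetric. *)
Definition lie_ideal (F : fieldType) (L : lieAlgType F) (I : {vspace L}) : Prop :=
  forall x y : L, y \in I -> bracket x y \in I.

Definition near_perfect_ideal (F : fieldType) (L : lieAlgType F)
    (I : {vspace L}) : Prop :=
  lie_ideal I /\ bracket_span fullv I = [set x | x \in I].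

(* Main.v *)
Require Import Defs.
From HB Require Import structures.
From mathcomp Require Import all_boot all_order all_algebra.
From mathcomp Require Import complex.
From mathcomp Require Import boolp classical_sets reals.

Set Implicit Arguments.
Unset Strict Implicit.
Unset Printing Implicit Defensive.

Import GRing.Theory.
Local Open Scope ring_scope.
Local Open Scope classical_set_scope.

(** The bracket is additive in its second argument, so [I + J] is an ideal
    ([lie_idealD]), and an ideal, being a subspace stable under bracketing,
    contains the span of its brackets with [L] ([bracket_span_sub]).
    Conversely, an element of [I + J] is a sum [y + z] with [y] in [I] and [z]
    in [J]; near perfection writes [y] and [z] as linear combinations of
    brackets of [L] with [I] and with [J], all of which are brackets of [L] with
    [I + J] ([bracket_spanSr]), and the sum of two linear combinations is again
    one ([linear_spanD]). *)

(** Concatenating two linear combinations, indexed by ['I_n] and ['I_m], gives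
    one indexed by ['I_(n + m)]. *)
Lemma linear_spanD (F : fieldType) (V : vectType F) (S : set V) (u v : V) :
  linear_span S u -> linear_span S v -> linear_span S (u + v).
Proof.
move=> [n [a [s [Ss ->]]]] [m [b [t [St ->]]]].
exists (n + m)%N.
exists (fun i => match split i with inl j => a j | inr j => b j end).
exists (fun i => match split i with inl j => s j | inr j => t j end).
split; first by move=> i; case: (split i).
rewrite big_split_ord /=; congr (_ + _); apply: eq_bigr => i _.
- by rewrite (unsplitK (inl i)).
- by rewrite (unsplitK (inr i)).
Qed.

Lemma linear_span_subset (F : fieldType) (V : vectType F) (S T : set V) :
  S `<=` T -> linear_span S `<=` linear_span T.
Proof.
move=> ST v [n [a [s [Ss ->]]]].
by exists n, a, s; split=> // i; apply: ST.
Qed.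

Lemma linear_span_sub_vspace (F : fieldType) (V : vectType F) (S : set V)
    (U : {vspace V}) :
  S `<=` [set x | x \in U] -> linear_span S `<=` [set x | x \in U].
Proof.
move=> SU v [n [a [s [Ss ->]]]] /=.
by apply: memv_suml => i _; apply: memvZ; apply: SU.
Qed.

Lemma bracketDr (F : fieldType) (L : lieAlgType F) (x y z : L) :
  bracket x (y + z) = bracket x y + bracket x z.
Proof. by have := bracket_linear_r 1 y z x; rewrite !scale1r. Qed.

Lemma lie_idealD (F : fieldType) (L : lieAlgType F) (I J : {vspace L}) :
  lie_ideal I -> lie_ideal J -> lie_ideal (I + J)%VS.
Proof.
move=> idI idJ x _ /memv_addP[y Iy [z Jz ->]].
by rewrite bracketDr memv_add ?idI ?idJ.
Qed.

Lemma bracket_span_sub (F : fieldType) (L : lieAlgType F) (I : {vspace L}) :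
  lie_ideal I -> bracket_span fullv I `<=` [set x | x \in I].
Proof.
move=> idI; apply: linear_span_sub_vspace => _ [x [y [_ Iy ->]]].
exact: idI.
Qed.

Lemma bracket_spanSr (F : fieldType) (L : lieAlgType F) (H I J : {vspace L}) :
  (I <= J)%VS -> bracket_span H I `<=` bracket_span H J.
Proof.
move=> /subvP sIJ; apply: linear_span_subset => _ [x [y [Hx Iy ->]]].
by exists x, y; split=> //; apply: sIJ.
Qed.

Lemma near_perfect_idealD (F : fieldType) (L : lieAlgType F)
    (I J : {vspace L}) :
  near_perfect_ideal I -> near_perfect_ideal J -> near_perfect_ideal (I + J)%VS.
Proof.
move=> [idI npI] [idJ npJ].
have idIJ := lie_idealD idI idJ.
split=> //; apply/seteqP; split; first exact: bracket_span_sub.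
move=> _ /memv_addP[y Iy [z Jz ->]].
apply: linear_spanD.
- by apply: (bracket_spanSr (addvSl I J)); rewrite npI.
- by apply: (bracket_spanSr (addvSr I J)); rewrite npJ.
Qed.

Theorem proposition3p1 (R : realType) (k : ground_field)
    (L : lieAlgType (scalars R k)) (I J : {vspace L}) :
  near_perfect_ideal I -> near_perfect_ideal J -> near_perfect_ideal (I + J)%VS.
Proof. exact: near_perfect_idealD. Qed.
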